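(* Let $\mathbf{A}$ be a finitely subdirectly irreducible De Morgan monoid that is not idempotent, and let $G$ be a deductive filter of $\mathbf{A}$ with $\neg(f^2)\in G$. Then $\mathbf{A}/G$ is an odd Sugihara monoid.
   Context: An involutive (commutative) residuated lattice (IRL) is an algebra $\langle A;\cdot,\wedge,\vee,\neg,e\rangle$ such that $\langle A;\cdot,e\rangle$ is a commutative monoid, $\langle A;\wedge,\vee\rangle$ is a lattice with order $\leqslant$, $\neg\neg x=x$, and $x\cdot y\leqslant z\iff \neg z\cdot y\leqslant\neg x$. Write $f:=\neg e$, $x\to y:=\neg(x\cdot\neg y)$, $x^2:=x\cdot x$. A De Morgan monoid is an IRL with distributive lattice reduct satisfying $x\leqslant x^2$; a Sugihara monoid is a De Morgan monoid satisfying $x^2=x$; an IRL is odd if $f=e$. An algebra is idempotent if $x^2=x$ for all its elements. An algebra is finitely subdirectly irreducible if its identity relation is meet-irreducible in its congruence lattice. A deductive filter of $\mathbf{A}$ is a lattice filter of $\langle A;\wedge,\vee\rangle$ that is also a submonoid of $\langle A;\cdot,e\rangle$; $\mathbf{A}/G$ denotes the quotient of $\mathbf{A}$ by the congruence $\{\langle a,b\rangle\in A^2: a\to b\in G \text{ and } b\to a\in G\}$. *)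

(* Defs.v *)
From HB Require Import structures.
From mathcomp Require Import all_boot all_order.
From mathcomp Require Import generic_quotient.
From mathcomp Require Import boolp classical_sets.

Set Implicit Arguments.
Unset Strict Implicit.
Unset Printing Implicit Defensive.

Import Order.TTheory.

Declare Scope irl_scope.
Delimit Scope irl_scope with irl.
Local Open Scope group_scope.
Local Open Scope order_scope.
Local Open Scope quotient_scope.
Local Open Scope irl_scope.

(* Involutive (commutative) residuated lattices. The monoid is MathComp's
   multiplicative monoid (x * y and 1 in group_scope, 1 being the neutral
   element e); the lattice is MathComp's. *)
HB.mixin Record isIRL d T of monoid.Monoid T & Order.Lattice d T := {
  neg : T -> T;
  irl_mulC : commutative (fun x y : T => x * y);
  negK : involutive neg;
  irl_residuated : forall x y z : T,
    (x * y <= z) = (neg z * y <= neg x)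
}.

#[short(type="irlType")]
HB.structure Definition IRL d :=
  { T of monoid.Monoid T & Order.Lattice d T & isIRL d T }.

Notation "¬ x" := (neg x) (at level 35, right associativity) : irl_scope.

Section Notions.
Context {d : Order.disp_t}.

Definition fconst (A : irlType d) : A := ¬ 1.

Definition imp {A : irlType d} (x y : A) : A := ¬ (x * ¬ y).

Definition idempotent_irl (A : irlType d) : Prop := forall x : A, x * x = x.

Definition odd_irl (A : irlType d) : Prop := fconst A = 1.

Definition DeMorgan_monoid (A : irlType d) : Prop :=
  left_distributive (@Order.meet d A) (@Order.join d A) /\
  forall x : A, x <= x * x.

Definition Sugihara_monoid (A : irlType d) : Prop :=
  DeMorgan_monoid A /\ idempotent_irl A.

Record congruence (A : irlType d) (r : set (A * A)) : Prop := {
  congruence_refl : forall x, r (x, x);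
  congruence_sym : forall x y, r (x, y) -> r (y, x);
  congruence_trans : forall x y z, r (x, y) -> r (y, z) -> r (x, z);
  congruence_mul : forall x x' y y',
    r (x, x') -> r (y, y') -> r (x * y, x' * y');
  congruence_meet : forall x x' y y',
    r (x, x') -> r (y, y') -> r (x `&` y, x' `&` y');
  congruence_join : forall x x' y y',
    r (x, x') -> r (y, y') -> r (x `|` y, x' `|` y');
  congruence_neg : forall x x', r (x, x') -> r (¬ x, ¬ x')
}.

(* Meets in the congruence lattice are intersections. *)
Definition finitely_subdirectly_irreducible (A : irlType d) : Prop :=
  forall r s : set (A * A), congruence r -> congruence s ->
    (r `&` s)%classic = diagonal -> r = diagonal \/ s = diagonal.

Record lattice_filter (A : irlType d) (G : set A) : Prop := {
  filter_nonempty : exists x, G x;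
  filter_up : forall x y, x <= y -> G x -> G y;
  filter_meet : forall x y, G x -> G y -> G (x `&` y)
}.

Record deductive_filter (A : irlType d) (G : set A) : Prop := {
  deductive_lattice_filter :> lattice_filter G;
  deductive_one : G 1;
  deductive_mul : forall x y, G x -> G y -> G (x * y)
}.

Definition filter_congruence (A : irlType d) (G : set A) : set (A * A) :=
  [set ab | G (imp ab.1 ab.2) /\ G (imp ab.2 ab.1)].

End Notions.

Section IRLTheory.
Context {d : Order.disp_t} {A : irlType d}.
Implicit Types x y z a b c g : A.

Lemma leN x y : (¬ x <= ¬ y) = (y <= x).
Proof. by have := irl_residuated y 1 x; rewrite !mulg1. Qed.

Lemma imp_residuated x y z : (x <= imp y z) = (x * y <= z).
Proof.
by rewrite irl_residuated /imp (irl_mulC (¬ z) y) -[RHS]leN negK.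
Qed.

Lemma imp_mul_le x y : imp x y * x <= y.
Proof. by rewrite -imp_residuated. Qed.

Lemma le_mul2r z x y : x <= y -> x * z <= y * z.
Proof.
by move=> xy; rewrite -imp_residuated (le_trans xy)// imp_residuated.
Qed.

Lemma le_mul2l z x y : x <= y -> z * x <= z * y.
Proof. by rewrite ![z * _]irl_mulC; exact: le_mul2r. Qed.

Lemma le_mul x x' y y' : x <= x' -> y <= y' -> x * y <= x' * y'.
Proof. by move=> xx yy; apply: le_trans (le_mul2r _ xx) (le_mul2l _ yy). Qed.

End IRLTheory.

Section FilterCongruence.
Context {d : Order.disp_t} {A : irlType d}.
Variables (G : set A) (dG : deductive_filter G).
Implicit Types x y z a b c g : A.

Lemma filter_impP a b : G (imp a b) <-> exists2 g, G g & g * a <= b.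
Proof.
split=> [Gab|[g Gg]]; first by exists (imp a b) => //; exact: imp_mul_le.
by rewrite -imp_residuated => /(filter_up dG); exact.
Qed.

Lemma filter_imp_le a b : a <= b -> G (imp a b).
Proof.
move=> ab; apply/filter_impP; exists 1; first exact: deductive_one.
by rewrite mul1g.
Qed.

Lemma filter_imp_trans b a c : G (imp a b) -> G (imp b c) -> G (imp a c).
Proof.
move=> /filter_impP[g Gg gab] /filter_impP[h Gh hbc]; apply/filter_impP.
exists (h * g); first exact: deductive_mul.
by rewrite -mulgA (le_trans _ hbc)// le_mul2l.
Qed.

Lemma filter_imp_neg a b : G (imp a b) -> G (imp (¬ b) (¬ a)).
Proof.
move=> /filter_impP[g Gg gab]; apply/filter_impP; exists g => //.
by rewrite irl_mulC -irl_residuated irl_mulC.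
Qed.

Lemma filter_imp_mul a a' b b' :
  G (imp a a') -> G (imp b b') -> G (imp (a * b) (a' * b')).
Proof.
move=> /filter_impP[g Gg gaa] /filter_impP[h Gh hbb]; apply/filter_impP.
exists (g * h); first exact: deductive_mul.
by rewrite -mulgA [h * _]irl_mulC -mulgA mulgA le_mul // irl_mulC.
Qed.

Lemma filter_imp_meet a a' b b' :
  G (imp a a') -> G (imp b b') -> G (imp (a `&` b) (a' `&` b')).
Proof.
move=> /filter_impP[g Gg gaa] /filter_impP[h Gh hbb]; apply/filter_impP.
exists (g `&` h); first exact: (filter_meet dG).
rewrite lexI; apply/andP; split.
- by apply: le_trans gaa; apply: le_mul; exact: leIl.
- by apply: le_trans hbb; apply: le_mul; exact: leIr.
Qed.

Lemma filter_imp_join a a' b b' :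
  G (imp a a') -> G (imp b b') -> G (imp (a `|` b) (a' `|` b')).
Proof.
move=> /filter_impP[g Gg gaa] /filter_impP[h Gh hbb]; apply/filter_impP.
exists (g `&` h); first exact: (filter_meet dG).
rewrite irl_mulC -imp_residuated leUx !imp_residuated ![_ * (g `&` h)]irl_mulC.
apply/andP; split.
- by apply: le_trans (le_trans (le_mul2r _ (leIl _ _)) gaa) (leUl _ _).
- by apply: le_trans (le_trans (le_mul2r _ (leIr _ _)) hbb) (leUr _ _).
Qed.

Lemma filter_congruenceP : congruence (filter_congruence G).
Proof.
split=> /=.
- by move=> x; split; exact: filter_imp_le.
- by move=> x y [].
- by move=> x y z [xy yx] [yz zy]; split; exact: (@filter_imp_trans y).
- by move=> x x' y y' [? ?] [? ?]; split; exact: filter_imp_mul.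
- by move=> x x' y y' [? ?] [? ?]; split; exact: filter_imp_meet.
- by move=> x x' y y' [? ?] [? ?]; split; exact: filter_imp_join.
- by move=> x x' [? ?]; split; exact: filter_imp_neg.
Qed.

Definition filter_rel : rel A := fun a b => `[< filter_congruence G (a, b) >].

Lemma filter_rel_equiv : equiv_class_of filter_rel.
Proof.
split.
- by move=> x; apply/asboolP; exact: (congruence_refl filter_congruenceP).
- by move=> x y; apply/asboolP/asboolP;
    exact: (congruence_sym filter_congruenceP).
- move=> y x z /asboolP xy /asboolP yz; apply/asboolP.
  exact: (congruence_trans filter_congruenceP) xy yz.
Qed.

Canonical filter_equiv := EquivRelPack filter_rel_equiv.

End FilterCongruence.

Definition filter_quotient {d : Order.disp_t} {A : irlType d} (G : set A)
  (dG : deductive_filter G) : Type := {eq_quot (filter_equiv dG)}.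

Section Quotient.
Context {d : Order.disp_t} {A : irlType d}.
Variables (G : set A) (dG : deductive_filter G).

Local Notation Q := (filter_quotient dG).

HB.instance Definition _ := Choice.copy Q {eq_quot (filter_equiv dG)}.
HB.instance Definition _ := EqQuotient.copy Q {eq_quot (filter_equiv dG)}.

Definition quo (a : A) : Q := \pi_Q a.

Lemma quo_eqP (a b : A) : quo a = quo b <-> filter_congruence G (a, b).
Proof.
split=> [/eqP|ab]; last by apply/eqP; rewrite eqmodE; apply/asboolP.
by rewrite eqmodE => /asboolP.
Qed.

Lemma quo_ind (P : Q -> Prop) : (forall a, P (quo a)) -> forall x, P x.
Proof. by move=> PA x; rewrite -[x]reprK. Qed.

(* The operations on classes are defined through chosen representatives; the
   lemmas quo_*E show independence of the choice. *)
Definition quo_one : Q := quo 1.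
Definition quo_mul (x y : Q) : Q := quo (repr x * repr y).
Definition quo_meet (x y : Q) : Q := quo (repr x `&` repr y).
Definition quo_join (x y : Q) : Q := quo (repr x `|` repr y).
Definition quo_neg (x : Q) : Q := quo (¬ repr x).
Definition quo_le : rel Q := fun x y => quo_meet x y == x.

Lemma quo_repr (a : A) : filter_congruence G (repr (quo a), a).
Proof. by apply/quo_eqP; rewrite /quo reprK. Qed.

Let congG := filter_congruenceP dG.

Lemma quo_mulE a b : quo_mul (quo a) (quo b) = quo (a * b).
Proof. by apply/quo_eqP; apply: (congruence_mul congG); exact: quo_repr. Qed.

Lemma quo_meetE a b : quo_meet (quo a) (quo b) = quo (a `&` b).
Proof. by apply/quo_eqP; apply: (congruence_meet congG); exact: quo_repr. Qed.

Lemma quo_joinE a b : quo_join (quo a) (quo b) = quo (a `|` b).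
Proof. by apply/quo_eqP; apply: (congruence_join congG); exact: quo_repr. Qed.

Lemma quo_negE a : quo_neg (quo a) = quo (¬ a).
Proof. by apply/quo_eqP; apply: (congruence_neg congG); exact: quo_repr. Qed.

Lemma quo_leP a b : quo_le (quo a) (quo b) <-> G (imp a b).
Proof.
rewrite /quo_le quo_meetE; split=> [/eqP/quo_eqP[/= _ ab]|ab].
  exact: (filter_imp_trans dG ab (filter_imp_le dG (leIr _ _))).
apply/eqP/quo_eqP; split=> /=; first exact: (filter_imp_le dG (leIl _ _)).
have := filter_imp_meet dG (filter_imp_le dG (lexx a)) ab.
by rewrite meetxx.
Qed.

Lemma quo_mulA : associative quo_mul.
Proof.
by elim/quo_ind=> a; elim/quo_ind=> b; elim/quo_ind=> c; rewrite !quo_mulE mulgA.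
Qed.

Lemma quo_mulC : commutative quo_mul.
Proof. by elim/quo_ind=> a; elim/quo_ind=> b; rewrite !quo_mulE irl_mulC. Qed.

Lemma quo_mul1 : left_id quo_one quo_mul.
Proof. by elim/quo_ind=> a; rewrite quo_mulE mul1g. Qed.

Lemma quo_mulr1 : right_id quo_one quo_mul.
Proof. by move=> x; rewrite quo_mulC quo_mul1. Qed.

Lemma quo_meetC : commutative quo_meet.
Proof. by elim/quo_ind=> a; elim/quo_ind=> b; rewrite !quo_meetE meetC. Qed.

Lemma quo_joinC : commutative quo_join.
Proof. by elim/quo_ind=> a; elim/quo_ind=> b; rewrite !quo_joinE joinC. Qed.

Lemma quo_meetA : associative quo_meet.
Proof.
by elim/quo_ind=> a; elim/quo_ind=> b; elim/quo_ind=> c; rewrite !quo_meetE meetA.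
Qed.

Lemma quo_joinA : associative quo_join.
Proof.
by elim/quo_ind=> a; elim/quo_ind=> b; elim/quo_ind=> c; rewrite !quo_joinE joinA.
Qed.

Lemma quo_joinKI y x : quo_meet x (quo_join x y) = x.
Proof.
by elim/quo_ind: x => a; elim/quo_ind: y => b; rewrite quo_joinE quo_meetE joinKI.
Qed.

Lemma quo_meetKU y x : quo_join x (quo_meet x y) = x.
Proof.
by elim/quo_ind: x => a; elim/quo_ind: y => b; rewrite quo_meetE quo_joinE meetKU.
Qed.

Lemma quo_le_refl : reflexive quo_le.
Proof. by elim/quo_ind=> a; apply/quo_leP; exact: (filter_imp_le dG). Qed.

Lemma quo_le_anti : antisymmetric quo_le.
Proof. by move=> x y /andP[/eqP xy /eqP yx]; rewrite -xy quo_meetC yx. Qed.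

Lemma quo_le_trans : transitive quo_le.
Proof.
elim/quo_ind=> b; elim/quo_ind=> a; elim/quo_ind=> c.
by move=> /quo_leP ab /quo_leP bc; apply/quo_leP; exact: (filter_imp_trans dG ab).
Qed.

Lemma quo_negK : involutive quo_neg.
Proof. by elim/quo_ind=> a; rewrite !quo_negE negK. Qed.

Lemma quo_residuated x y z :
  quo_le (quo_mul x y) z = quo_le (quo_mul (quo_neg z) y) (quo_neg x).
Proof.
elim/quo_ind: x => x; elim/quo_ind: y => y; elim/quo_ind: z => z.
have mulCA (g a b : A) : g * (a * b) = a * (g * b).
  by rewrite !mulgA (irl_mulC g).
rewrite !quo_negE !quo_mulE.
apply/idP/idP => /quo_leP Gle; apply/quo_leP; apply/(filter_impP dG);
  move: Gle => /(filter_impP dG)[g Gg gl]; exists g => //.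
- by rewrite mulCA -irl_residuated mulCA.
- by rewrite mulCA irl_residuated mulCA.
Qed.

HB.instance Definition _ :=
  monoid.isMonoid.Build Q quo_mulA quo_mul1 quo_mulr1.
HB.instance Definition _ :=
  Order.Le_isPOrder.Build d Q quo_le_refl quo_le_anti quo_le_trans.
HB.instance Definition _ :=
  Order.POrder_isLattice.Build d Q quo_meetC quo_joinC quo_meetA quo_joinA
    quo_joinKI quo_meetKU (fun _ _ => erefl).
HB.instance Definition _ :=
  isIRL.Build d Q quo_mulC quo_negK quo_residuated.

Lemma quo_hom (a b : A) :
  [/\ quo 1 = 1,
      quo (a * b) = quo a * quo b,
      quo (a `&` b) = quo a `&` quo b,
      quo (a `|` b) = quo a `|` quo b
    & quo (¬ a) = ¬ quo a].
Proof.
by split; [| exact/esym/quo_mulE | exact/esym/quo_meetE | exact/esym/quo_joinE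
           | exact/esym/quo_negE].
Qed.

End Quotient.

(* Main.v *)
Require Import Defs.
From mathcomp Require Import all_boot all_order.
From mathcomp Require Import boolp classical_sets.

(** In an involutive residuated lattice with [x <= x * x], idempotency is
    equivalent to [f <= e], and also to [f * f <= f].  Finite subdirect
    irreducibility makes [e] join-prime, so [e <= f * f] or [e <= ¬ (f * f)],
    i.e. [f * f <= f]; the latter is excluded as the algebra is not idempotent.
    Thus [¬ (f * f) <= ¬ e = f], whence [f] belongs to [G].  Now
    [imp e f = f] and [imp f e = ¬ (f * f)] both lie in [G], so the quotient is
    odd, and then idempotent by the first equivalence. *)

Set Implicit Arguments.
Unset Strict Implicit.
Unset Printing Implicit Defensive.

Import Order.TTheory.

Local Open Scope group_scope.
Local Open Scope order_scope.
Local Open Scope irl_scope.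

Section SquareIncreasing.
Context {d : Order.disp_t} {A : irlType d}.
Implicit Types x y a b : A.

Lemma imp1r x : imp 1 x = x.
Proof. by rewrite /imp mul1g negK. Qed.

Lemma impr1_fconst : imp (fconst A) 1 = ¬ (fconst A * fconst A).
Proof. by []. Qed.

Lemma mulN_le_fconst x : x * ¬ x <= fconst A.
Proof. by rewrite irl_residuated /fconst negK mul1g. Qed.

Hypothesis sqr_ge : forall x, x <= x * x.

(** Excluded middle, by De Morgan duality: [¬ x ∧ x] lies below its square, hence below
    [x * ¬ x <= f]. *)
Lemma le1_joinN x : 1 <= x `|` ¬ x.
Proof.
have meet_le : ¬ x `&` x <= fconst A.
  apply: le_trans (sqr_ge _) (le_trans (le_mul (leIr _ _) (leIl _ _)) _).
  exact: mulN_le_fconst.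
rewrite -leN; apply: le_trans meet_le; rewrite lexI -[X in _ && (_ <= X)]negK.
by rewrite !leN leUl leUr.
Qed.

Lemma fconst_le1_idempotent : fconst A <= 1 -> idempotent_irl A.
Proof.
move=> f1 x; apply/le_anti; rewrite sqr_ge andbT.
(* Contraction, i.e. [sqr_ge] for [¬ x], is [imp (¬ x) x <= x]. *)
apply: (@le_trans _ _ (imp (¬ x) x)); last by rewrite -leN /imp negK sqr_ge.
rewrite imp_residuated -mulgA -[leRHS]mulg1 le_mul2l //.
exact: le_trans (mulN_le_fconst x) f1.
Qed.

Lemma fconst_sqr_le_idempotent :
  fconst A * fconst A <= fconst A -> idempotent_irl A.
Proof.
move=> ff; apply: fconst_le1_idempotent.
(* By residuation [f <= 1] says [1 <= imp f 1 = ¬ (f * f)]; contraposition turns this into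
   [f * f <= f]. *)
by rewrite -[leLHS]mul1g -imp_residuated -leN /imp negK.
Qed.

Lemma principal_deductive_filter a :
  a <= 1 -> deductive_filter [set x | a <= x]%classic.
Proof.
move=> a1; split=> //=.
- split=> [|x y /= xy ax|x y /= ax ay].
  + by exists a => /=.
  + exact: le_trans ax xy.
  + by rewrite lexI ax.
- by move=> x y ax ay; exact: le_trans (sqr_ge a) (le_mul ax ay).
Qed.

(** The congruence of the filter generated by [a] identifies [a] with [1], because [imp 1 a = a]. *)
Lemma principal_congruence_diagonal a : a <= 1 ->
  filter_congruence [set x | a <= x]%classic = diagonal -> a = 1.
Proof.
move=> a1 diag.
have : filter_congruence [set x | a <= x]%classic (a, 1).
  split=> /=; last by rewrite imp1r.
  by apply: (le_trans a1); rewrite imp_residuated mul1g.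
by rewrite diag.
Qed.

End SquareIncreasing.

(** The filters generated by [x ∧ 1] and [y ∧ 1] give congruences that meet in the diagonal, since
    by distributivity the generators join to [1]. One congruence is then trivial, so its generator
    is [1]. *)
Lemma fsi_one_join_prime (d : Order.disp_t) (A : irlType d) :
    DeMorgan_monoid A -> finitely_subdirectly_irreducible A ->
  forall x y : A, 1 <= x `|` y -> 1 <= x \/ 1 <= y.
Proof.
move=> [distr sqr_ge] fsi x y xy1.
have lea (z : A) : z `&` 1 <= 1 by exact: leIr.
have dF z := principal_deductive_filter sqr_ge (lea z).
have join1 : (x `&` 1) `|` (y `&` 1) = 1.
  by rewrite -distr; apply/meet_idPr.
have [] := fsi _ _ (filter_congruenceP (dF x)) (filter_congruenceP (dF y)).
- apply/seteqP; rewrite /diagonal; split=> [[a b] /= [[/= xab xba] [/= yab yba]]|[a b] /= ->].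
    (* Here [a <= b] becomes [1 <= imp a b], with [1] the join of the two generators, each of which
       lies below [imp a b]. *)
    apply/le_anti; rewrite -[a in X in X && _]mul1g -[b in X in _ && X]mul1g.
    by rewrite -!imp_residuated -join1 !leUx xab xba yab yba.
  by split; exact: (congruence_refl (filter_congruenceP (dF _))).
- by move/(principal_congruence_diagonal (lea x)) => <-; left; exact: leIl.
- by move/(principal_congruence_diagonal (lea y)) => <-; right; exact: leIl.
Qed.

Lemma filter_quotient_DeMorgan (d : Order.disp_t) (A : irlType d) (G : set A)
    (dG : deductive_filter G) :
  DeMorgan_monoid A -> DeMorgan_monoid (filter_quotient dG).
Proof.
move=> [distr sqr_ge]; split.
- move=> x y z; elim/(@quo_ind _ _ _ dG): x => a.
  elim/(@quo_ind _ _ _ dG): y => b; elim/(@quo_ind _ _ _ dG): z => c.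
  have homU u v : quo dG u `|` quo dG v = quo dG (u `|` v).
    by case: (quo_hom dG u v).
  have homI u v : quo dG u `&` quo dG v = quo dG (u `&` v).
    by case: (quo_hom dG u v).
  by rewrite homU !homI homU distr.
- elim/(@quo_ind _ _ _ dG) => a; have [_ <- _ _ _] := quo_hom dG a a.
  by apply/quo_leP; exact: filter_imp_le.
Qed.

Theorem theorem5p12 (d : Order.disp_t) (A : irlType d)
    (hA : DeMorgan_monoid A)
    (hFSI : finitely_subdirectly_irreducible A)
    (hnid : ~ idempotent_irl A)
    (G : set A) (dG : deductive_filter G)
    (hG : G (¬ (fconst A * fconst A))) :
  Sugihara_monoid (filter_quotient dG) /\ odd_irl (filter_quotient dG).
Proof.
have [_ sqr_ge] := hA.
have dmQ := filter_quotient_DeMorgan dG hA.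
have one_le : 1 <= fconst A * fconst A.
  have [//|ff] := fsi_one_join_prime hA hFSI (le1_joinN sqr_ge (fconst A * fconst A)).
  case: hnid; apply: (fconst_sqr_le_idempotent sqr_ge).
  by rewrite -leN /fconst negK.
have Gf : G (fconst A).
  by apply: (filter_up dG _ hG); rewrite [leRHS]/fconst leN.
have oddQ : odd_irl (filter_quotient dG).
  have [one_hom _ _ _ neg_hom] := quo_hom dG 1 1.
  rewrite /odd_irl /fconst -one_hom -neg_hom; apply/quo_eqP.
  by split=> /=; rewrite ?imp1r ?impr1_fconst.
split=> //; split=> //.
by apply: (fconst_le1_idempotent dmQ.2); rewrite oddQ.
Qed.
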